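(* There is a constant $C$ such that the following holds. Let $\Sigma$ be a finite alphabet, $R\subset\Sigma^T$ a TEP family, $n\ge1$, and $P,Q\subseteq T_n$ bases with $|P|=|Q|=n$. Fix bijections of $P$ and $Q$ with $\{1,\ldots,n\}$, thereby identifying $\Sigma^P$ and $\Sigma^Q$ with $\Sigma^n$, and let $\phi:\Sigma^n\to\Sigma^n$ be the map sending $p\in\Sigma^P$ to the restriction to $Q$ of the unique valid pattern on $T_n$ extending $p$. Then $\phi$ is a composition of at most $C n^3$ basic permutations of $\Sigma^n$.
   Context: Let $T=\{(0,1),(1,1),(1,0)\}$ and $T_n=\{(a,b)\in\{0,\ldots,n-1\}^2 : a+b\geq n-1\}$. A set $R\subset\Sigma^T$ is a TEP family if for every labelling $\{a,b,c\}=T$ and every $p\in\Sigma^{\{a,b\}}$ there is a unique $s\in\Sigma$ such that the pattern extending $p$ by $c\mapsto s$ lies in $R$. A pattern $q\in\Sigma^{T_n}$ is valid if for every $v$ with $v+T\subseteq T_n$ the pattern $t\mapsto q_{v+t}$ ($t\in T$) lies in $R$. For $P\subseteq T_n$, $P$ is a basis if for every $q\in\Sigma^P$, the process of iteratively completing partially filled triangles (whenever a translate $v+T$ has exactly two assigned cells, assign the third the unique symbol making the triangle's content lie in $R$) always ends with a valid pattern on all of $T_n$. A basic permutation of $\Sigma^n$ is a bijection $\pi$ for which there are two distinct indices $i\ne j$ and $\hat\pi\in\mathrm{Sym}(\Sigma^2)$ such that $\pi$ replaces $(a_i,a_j)$ by $\hat\pi(a_i,a_j)$ and leaves all other coordinates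 unchanged. *)

(* Defs.v *)
From Stdlib Require Export Relation_Operators.
From Stdlib Require Import Classical.
From mathcomp Require Export all_boot all_fingroup.

Set Implicit Arguments.
Unset Strict Implicit.
Unset Printing Implicit Defensive.

Definition T : finType := seq_sub [:: (0, 1); (1, 1); (1, 0)].

Definition Tn (n : nat) : finType :=
  {c : 'I_n * 'I_n | n.-1 <= c.1 + c.2}.

Definition coords (n : nat) (c : Tn n) : nat * nat :=
  ((val c).1 : nat, (val c).2 : nat).

Definition TEP (Sigma : finType) (R : {set {ffun T -> Sigma}}) : Prop :=
  forall a b c : T, a != b -> a != c -> b != c ->
  forall x y : Sigma, exists! s : Sigma,
    [ffun t => if t == a then x else if t == b then y else s] \in R.

(* w enumerates a translate v + T contained in T_n.  A v in Z^2 with            *)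
(* v + T included in T_n has nonnegative coordinates, because (0,1) and (1,0)   *)
(* belong to T; so v may be taken in nat * nat.                                 *)
Definition translate (n : nat) (w : T -> Tn n) : Prop :=
  exists v : nat * nat,
    forall t : T, coords (w t) = (v.1 + (val t).1, v.2 + (val t).2).

Definition valid (Sigma : finType) (R : {set {ffun T -> Sigma}}) (n : nat)
    (q : {ffun Tn n -> Sigma}) : Prop :=
  forall w : T -> Tn n, translate w -> [ffun t => q (w t)] \in R.

(* Partially filled patterns: None marks an unassigned cell.                    *)
Definition partial (Sigma : finType) (n : nat) := {ffun Tn n -> option Sigma}.

(* The cell w c is the only unassigned one of the triangle w; r is the content  *)
(* of the completed triangle.  For a TEP family R, r is determined by its two   *)
(* already assigned values.                                                     *)
Definition fill_step (Sigma : finType) (R : {set {ffun T -> Sigma}}) (n : nat)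
    (u u' : partial Sigma n) : Prop :=
  exists (w : T -> Tn n) (c : T) (r : {ffun T -> Sigma}),
    [/\ translate w, r \in R,
        u (w c) = None,
        (forall t : T, t != c -> u (w t) = Some (r t)) &
        u' = [ffun d => if d == w c then Some (r c) else u d]].

Definition start (Sigma : finType) (n : nat) (P : {set Tn n})
    (p : {ffun {d | d \in P} -> Sigma}) : partial Sigma n :=
  [ffun d => omap p (insub d)].

(* Every step assigns one more cell, so every run reaches a state in which no   *)
(* step is possible; each such state, whatever the order of the completions,    *)
(* is required to be a valid pattern on the whole of T_n.                       *)
Definition is_basis (Sigma : finType) (R : {set {ffun T -> Sigma}}) (n : nat)
    (P : {set Tn n}) : Prop :=
  forall (p : {ffun {d | d \in P} -> Sigma}) (u : partial Sigma n),
    clos_refl_trans_1n _ (@fill_step Sigma R n) (start p) u ->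
    (forall u', ~ fill_step R u u') ->
    exists2 q : {ffun Tn n -> Sigma}, valid R q & u = [ffun d => Some (q d)].

(* The restriction of q to P, read as an element of Sigma^n through the         *)
(* numbering e of P.                                                            *)
Definition restr (Sigma : finType) (n : nat) (P : {set Tn n})
    (e : 'I_n -> {d | d \in P}) (q : {ffun Tn n -> Sigma}) : {ffun 'I_n -> Sigma} :=
  [ffun i => q (val (e i))].

Definition basic_perm (Sigma : finType) (n : nat)
    (pi : {perm {ffun 'I_n -> Sigma}}) : Prop :=
  exists (i j : 'I_n) (h : {perm Sigma * Sigma}),
    i != j /\
    forall a : {ffun 'I_n -> Sigma},
      pi a = [ffun k => if k == i then (h (a i, a j)).1
                        else if k == j then (h (a i, a j)).2
                        else a k].

Lemma fill_ends (Sigma : finType) (R : {set {ffun T -> Sigma}}) (n : nat)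
    (u : partial Sigma n) :
  exists2 u', clos_refl_trans_1n _ (@fill_step Sigma R n) u u' &
              forall u'', ~ fill_step R u' u''.
Proof.
have [m] := ubnP #|[set d | u d == None]|; elim: m u => // m IH u ltm.
have [[u1 s1]|no] := classic (exists u1, fill_step R u u1); last first.
  by exists u; [exact: rt1n_refl | move=> u2 s2; apply: no; exists u2].
have [|u2 r2 e2] := IH u1; last first.
  by exists u2 => //; apply: rt1n_trans s1 r2.
case: s1 => w [c [r [_ _ uc _ ->]]]; apply: leq_trans (ltm : _ <= m).
apply: proper_card; apply/properP; split.
  by apply/subsetP => d; rewrite !inE ffunE; case: ifP.
by exists (w c); rewrite !inE ?ffunE ?eqxx ?uc.
Qed.

Lemma fill_keeps (Sigma : finType) (R : {set {ffun T -> Sigma}}) (n : nat)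
    (u u' : partial Sigma n) :
  clos_refl_trans_1n _ (@fill_step Sigma R n) u u' ->
  forall d s, u d = Some s -> u' d = Some s.
Proof.
elim=> // u1 u2 u3 [w [c [r [_ _ uc _ ->]]]] _ IH d s uds; apply: IH.
by rewrite ffunE; case: eqP => // e; rewrite e uc in uds.
Qed.

Lemma TEP_inj (Sigma : finType) (R : {set {ffun T -> Sigma}}) (c : T)
    (r r' : {ffun T -> Sigma}) : TEP R -> r \in R -> r' \in R ->
  (forall t, t != c -> r t = r' t) -> r = r'.
Proof.
move=> tep rR r'R eqr.
have [a [b [ab ac bc cov]]] : exists a b : T,
    [/\ a != b, a != c, b != c & forall t, [|| t == a, t == b | t == c]].
  have i0 : (0, 1) \in [:: (0, 1); (1, 1); (1, 0)] by [].
  have i1 : (1, 1) \in [:: (0, 1); (1, 1); (1, 0)] by [].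
  have i2 : (1, 0) \in [:: (0, 1); (1, 1); (1, 0)] by [].
  have cv (t : T) : [|| val t == (0, 1), val t == (1, 1) | val t == (1, 0)].
    by have := valP t; rewrite !inE.
  case/or3P: (cv c) => /eqP vc.
  - exists (SeqSub i1), (SeqSub i2); rewrite -!val_eqE /= vc; split=> // t.
    by rewrite -!val_eqE /= vc; case/or3P: (cv t) => /= ->; rewrite ?orbT.
  - exists (SeqSub i0), (SeqSub i2); rewrite -!val_eqE /= vc; split=> // t.
    by rewrite -!val_eqE /= vc; case/or3P: (cv t) => /= ->; rewrite ?orbT.
  - exists (SeqSub i0), (SeqSub i1); rewrite -!val_eqE /= vc; split=> // t.
    by rewrite -!val_eqE /= vc; case/or3P: (cv t) => /= ->; rewrite ?orbT.
have [s [_ uniq_s]] := tep a b c ab ac bc (r a) (r b).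
have pat (r1 : {ffun T -> Sigma}) : r1 a = r a -> r1 b = r b ->
    [ffun t => if t == a then r a else if t == b then r b else r1 c] = r1.
  move=> e1 e2; apply/ffunP => t; rewrite ffunE.
  case: eqP => [->//|na]; case: eqP => [->//|nb].
  by case/or3P: (cov t) => /eqP e //; rewrite e.
have ec : r c = r' c.
  rewrite -(uniq_s (r c)) ?pat //; apply: uniq_s.
  by rewrite pat // -eqr.
by apply/ffunP => t; have [->//|/eqr] := eqVneq t c.
Qed.

Lemma fill_agrees (Sigma : finType) (R : {set {ffun T -> Sigma}}) (n : nat)
    (u u' : partial Sigma n) (q : {ffun Tn n -> Sigma}) :
  TEP R -> valid R q ->
  clos_refl_trans_1n _ (@fill_step Sigma R n) u u' ->
  (forall d s, u d = Some s -> q d = s) ->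
  forall d s, u' d = Some s -> q d = s.
Proof.
move=> tep vq; elim=> // u1 u2 u3 [w [c [r [tw rR uc ur ->]]]] _ IH qu.
apply: IH => d s; rewrite ffunE; case: eqP => [-> [<-]|_]; last exact: qu.
have <- : [ffun t => q (w t)] = r.
  apply: (TEP_inj (c := c) tep) => //; first exact: vq.
  by move=> t tc; rewrite ffunE; apply: qu; apply: ur.
by rewrite ffunE.
Qed.

Lemma basis_unique_extension (Sigma : finType) (R : {set {ffun T -> Sigma}})
    (n : nat) (P : {set Tn n}) (p : {ffun {d | d \in P} -> Sigma}) :
  TEP R -> is_basis R P ->
  exists! q : {ffun Tn n -> Sigma},
    valid R q /\ forall d : {d | d \in P}, q (val d) = p d.
Proof.
move=> tep bP; have [u ru eu] := fill_ends R (start p).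
have [q vq uq] := bP p u ru eu.
exists q; split=> [|q' [vq' q'p]].
  split=> // d; have := fill_keeps ru (d := val d) (s := p d).
  by rewrite uq /start !ffunE valK /= => /(_ erefl) [].
apply/ffunP => d; apply/esym.
apply: (fill_agrees tep vq' ru); last by rewrite uq ffunE.
move=> {}d s; rewrite /start ffunE; case: insubP => //= e _ <- [<-]; exact: q'p.
Qed.

(* Main.v *)
Require Import Defs.
From Stdlib Require Import Classical.
From mathcomp Require Import zify.

(* Replacing one of two cells of a small triangle by the third cell acts on the
   recorded symbols as a basic permutation, by TEP.  So it suffices to bring any
   basis with n cells to the base line of T_n by O(n^3) such moves; the order of
   the cells costs at most n further transpositions.

   In barycentric coordinates (x, y, z) with x + y + z = n - 1, the subtriangle
   with parameter u is the set of cells c >= u, of side n - |u|.  The smallest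
   triangle containing two others is given by min(u, w), and the two touch or
   overlap iff |max(u, w)| <= n.  From |u| + |w| = |min| + |max|, joining them
   never increases the sum of the sides, and preserves it iff |max(u, w)| = n.
   Starting from the cells of a filling set and joining as long as possible, one
   ends with the whole of T_n, so with n cells all joins are exact.  An exact join
   of sides a and b costs at most 3 (a + b)^2 moves on lines, which is at most
   2 ((a + b)^3 - a^3 - b^3), and the costs telescope to 2 n^3. *)

Set Implicit Arguments.
Unset Strict Implicit.
Unset Printing Implicit Defensive.

(** * Barycentric cells and small triangles *)

Definition cell := (nat * nat * nat)%type.

Definition csum (c : cell) : nat := c.1.1 + c.1.2 + c.2.

Definition cle (u c : cell) : bool :=
  [&& u.1.1 <= c.1.1, u.1.2 <= c.1.2 & u.2 <= c.2].

Definition cmin (u w : cell) : cell :=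
  (minn u.1.1 w.1.1, minn u.1.2 w.1.2, minn u.2 w.2).

Definition cmax (u w : cell) : cell :=
  (maxn u.1.1 w.1.1, maxn u.1.2 w.1.2, maxn u.2 w.2).

(** The pair (a, b) has barycentric coordinates (N - a, N - b, a + b - N), so (0,1), (1,0) and (1,1)
    raise the first, second and third coordinate of [v] by one. *)
Definition corner (v : cell) (t : T) : cell :=
  (v.1.1 + (1 - (val t).1), v.1.2 + (1 - (val t).2),
   v.2 + ((val t).1 + (val t).2 - 1)).

Definition tri (N : nat) (c d e : cell) : Prop :=
  exists (v : cell) (p q r : T),
    [/\ csum v + 1 = N, [&& p != q, p != r & q != r],
        c = corner v p, d = corner v q & e = corner v r].

Lemma tri_sym N c d e : tri N c d e -> tri N e d c.
Proof.
case=> v [p [q [r [vN /and3P[pq pr qr] -> -> ->]]]].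
by exists v, r, q, p; split; rewrite // eq_sym qr eq_sym pr eq_sym pq.
Qed.

Lemma tri_swap N c d e : tri N c d e -> tri N d c e.
Proof.
case=> v [p [q [r [vN /and3P[pq pr qr] -> -> ->]]]].
by exists v, q, p, r; split; rewrite // eq_sym pq qr pr.
Qed.

Lemma tri_rot N c d e : tri N c d e -> tri N d e c.
Proof. by move/tri_swap/tri_sym/tri_swap/tri_sym. Qed.

Definition t01 : T := SeqSub (isT : (0, 1) \in [:: (0, 1); (1, 1); (1, 0)]).
Definition t11 : T := SeqSub (isT : (1, 1) \in [:: (0, 1); (1, 1); (1, 0)]).
Definition t10 : T := SeqSub (isT : (1, 0) \in [:: (0, 1); (1, 1); (1, 0)]).

Lemma T_cases (t : T) : [\/ t = t01, t = t11 | t = t10].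
Proof.
have := valP t; rewrite !inE => /or3P[] /eqP e.
- by constructor 1; apply/val_inj.
- by constructor 2; apply/val_inj.
- by constructor 3; apply/val_inj.
Qed.

Lemma tri_corners N x y z : x + y + z + 1 = N ->
  tri N (x.+1, y, z) (x, y.+1, z) (x, y, z.+1).
Proof.
move=> e; exists (x, y, z), t01, t10, t11.
by split=> //; rewrite /corner /=; congr (_, _, _); lia.
Qed.

(** * Moves on lists of cells *)

Section Reach.
Variable N : nat.

(** Reordering is free here and is paid for once, at the very end. The number is only an upper bound
    on the moves, since [reach_perm] accepts any [m]. *)
Inductive reach : nat -> seq cell -> seq cell -> Prop :=
| reach_perm m s t : perm_eq s t -> reach m s t
| reach_move c d e s : tri N c d e -> reach 1 (c :: d :: s) (e :: d :: s)
| reach_trans m1 m2 s t u : reach m1 s t -> reach m2 t u -> reach (m1 + m2) s u.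

Lemma reach_le m m' s t : m <= m' -> reach m s t -> reach m' s t.
Proof.
move=> le r; rewrite -(subnKC le).
by apply: reach_trans r (reach_perm _ _).
Qed.

Lemma reach_sym m s t : reach m s t -> reach m t s.
Proof.
elim=> [{}m {}s {}t st|c d e {}s tr|m1 m2 {}s {}t u _ IH1 _ IH2].
- by apply: reach_perm; rewrite perm_sym.
- exact/reach_move/tri_sym.
- by rewrite addnC; apply: reach_trans IH2 IH1.
Qed.

Lemma reach_catr m s t u : reach m s t -> reach m (s ++ u) (t ++ u).
Proof.
elim=> [{}m {}s {}t st|c d e {}s tr|m1 m2 {}s {}t v _ IH1 _ IH2].
- by apply: reach_perm; rewrite perm_cat2r.
- exact: reach_move.
- exact: reach_trans IH1 IH2.
Qed.

Lemma reach_permL m s s' t : perm_eq s s' -> reach m s' t -> reach m s t.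
Proof. by move=> p r; rewrite -[m]add0n; apply: reach_trans (reach_perm _ p) r. Qed.

Lemma reach_permR m s t t' : perm_eq t t' -> reach m s t -> reach m s t'.
Proof. by move=> p r; rewrite -[m]addn0; apply: reach_trans r (reach_perm _ p). Qed.

Lemma reach_cat m1 m2 s t s' t' :
  reach m1 s t -> reach m2 s' t' -> reach (m1 + m2) (s ++ s') (t ++ t').
Proof.
move=> r1 r2; apply: reach_trans (reach_catr _ r1) _.
apply: (@reach_permL _ _ (s' ++ t)); first by rewrite perm_catC.
by apply: (@reach_permR _ _ (t' ++ t)); [rewrite perm_catC | apply: reach_catr].
Qed.

(** * Sweeping lines *)

(** One cell of the next row starts a chain reaction: each new cell of that row, with a neighbour in
    the old row, gives the next one, outwards from position [r] in both directions. *)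
Lemma reach_shift (src tgt : nat -> cell) a r : r <= a ->
  (forall t, t < a -> tri N (src t) (tgt t) (tgt t.+1)) ->
  reach a (tgt r :: mkseq src a) (mkseq tgt a.+1).
Proof.
elim: a r => [|a IH] r ra tr.
  by move: ra; rewrite leqn0 => /eqP->; apply: reach_perm.
have {}IH r' ra' := IH r' ra' (fun t ta => tr t (ltnW ta)).
rewrite (mkseqS tgt).
have [ra1|] := leqP r a.
  apply: (@reach_le (a + 1)); first by rewrite addn1.
  apply: (@reach_trans _ _ _ (rcons (mkseq tgt a.+1) (src a))).
    by rewrite (mkseqS src) -rcons_cons -!cats1; apply/reach_catr/IH.
  rewrite (mkseqS tgt); set s := mkseq tgt a.
  apply: (@reach_permL _ _ (src a :: tgt a :: s)).
    by rewrite perm_rcons perm_cons perm_rcons.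
  apply: (@reach_permR _ _ (tgt a.+1 :: tgt a :: s)).
    by rewrite perm_sym perm_rcons perm_cons perm_rcons.
  exact/reach_move/tr.
(* The given cell is the last one, so the last source first moves to [tgt a], which then serves as
   the given cell for the shorter row. *)
move=> ar; have -> : r = a.+1 by lia.
apply: (@reach_le (1 + a)) => //; apply: (@reach_trans _ _ _ (tgt a :: tgt a.+1 :: mkseq src a)).
  apply: (@reach_permL _ _ (src a :: tgt a.+1 :: mkseq src a)).
    by rewrite (mkseqS src) -rcons_cons perm_rcons.
  by apply: reach_move; apply/tri_sym/tri_rot/tr.
apply: (@reach_permL _ _ ((tgt a :: mkseq src a) ++ [:: tgt a.+1])).
  by apply/seq.permP => p; rewrite /= count_cat /=; lia.
by rewrite -cats1; apply/reach_catr/IH.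
Qed.

(* The edge on which the first coordinate is [l] of the triangle of size [a]
   whose points have coordinates at least [l], [y] and [z]; [mk] permutes the
   coordinates, so that one definition serves for all three edges. *)
Definition line (mk : nat -> nat -> nat -> cell) (l y z a : nat) : seq cell :=
  mkseq (fun t => mk l (y + t) (z + (a.-1 - t))) a.

Definition swap12 (mk : nat -> nat -> nat -> cell) := fun x y z => mk y x z.
Definition swap23 (mk : nat -> nat -> nat -> cell) := fun x y z => mk x z y.

Definition tri_coord (mk : nat -> nat -> nat -> cell) : Prop :=
  forall x y z, x + y + z + 1 = N ->
    tri N (mk x.+1 y z) (mk x y.+1 z) (mk x y z.+1).

Lemma tri_coord_swap12 mk : tri_coord mk -> tri_coord (swap12 mk).
Proof. by move=> h x y z e; apply/tri_swap/h; lia. Qed.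

Lemma tri_coord_swap23 mk : tri_coord mk -> tri_coord (swap23 mk).
Proof. by move=> h x y z e; apply/tri_sym/tri_rot/h; lia. Qed.

Lemma perm_line_swap23 mk l y z a :
  perm_eq (line (swap23 mk) l y z a) (line mk l z y a).
Proof.
suff -> : line (swap23 mk) l y z a = rev (line mk l z y a) by rewrite perm_rev.
apply: (@eq_from_nth _ (0, 0, 0)) => [|i]; rewrite ?size_rev !size_mkseq // => ia.
rewrite nth_rev ?size_mkseq // !nth_mkseq // /swap23; last by lia.
by congr mk; lia.
Qed.

(* The points of the second edge lie one on each level below the first line,
   which sweeps over them and grows by one at each level. *)
Lemma reach_merge mk l y0 z0 y z a b : tri_coord mk ->
  y0 <= y -> z0 <= z -> l + b + y0 + z0 + a = N.+1 -> y + z = y0 + z0 + a ->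
  reach (b * (a + b)) (line mk (l + b) y0 z0 a ++ line (swap12 mk) y l z b)
    (line mk l y0 z0 (a + b)).
Proof.
move=> hmk; elim: b z a => [|b IH] z a yy zz e1 e2.
  by rewrite !addn0 cats0; apply: reach_perm.
apply: (@reach_le (a + b * (a.+1 + b))); first by nia.
apply: (@reach_trans _ _ _ (line mk (l + b) y0 z0 a.+1 ++
                            line (swap12 mk) y l z.+1 b)); last first.
  by rewrite addnS -addSn; apply: IH => //; lia.
(* The last point of the second edge is the one on level [l + b], just below the first line. *)
have -> : line (swap12 mk) y l z b.+1 =
          rcons (line (swap12 mk) y l z.+1 b) (mk (l + b) y z).
  rewrite /line mkseqS; congr rcons; last by rewrite /swap12 /= subnn addn0.
  by apply/eq_in_map => i; rewrite mem_iota /swap12 => ib; congr mk; lia.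
apply: (@reach_permL _ _ ((mk (l + b) y z :: line mk (l + b.+1) y0 z0 a) ++
                            line (swap12 mk) y l z.+1 b)).
  by apply/seq.permP => P; rewrite -cats1 !(count_cat, cat_cons) /= !count_cat /=; lia.
apply: reach_catr.
(* By [e2] this point is at position [y - y0] of the enlarged line. *)
have -> : mk (l + b) y z =
   (fun t => mk (l + b) (y0 + t) (z0 + (a - t))) (y - y0).
  by congr mk; lia.
apply: reach_shift => [|t ta]; first by lia.
rewrite !addnS; set k := z0 + (a.-1 - t); have -> : z0 + (a - t) = k.+1 by rewrite /k; lia.
have -> : z0 + (a - t.+1) = k by rewrite /k; lia.
by apply/tri_sym/tri_rot/hmk; rewrite /k; lia.
Qed.

(** This is the merge with an empty first line. *)
Lemma reach_flip mk l y z a : tri_coord mk -> l + y + z + a = N.+1 ->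
  reach (a ^ 2) (line (swap12 mk) y l z a) (line mk l y z a).
Proof.
move=> hmk e; rewrite -mulnn -{2}[a]add0n -[X in line mk l y z X]add0n.
by apply: (@reach_merge mk l y z y z 0 a) => //; lia.
Qed.

Definition xyz (x y z : nat) : cell := (x, y, z).

Lemma tri_coord_xyz : tri_coord xyz.
Proof. by move=> x y z e; apply: tri_corners. Qed.

(** * Joining touching subtriangles *)

Definition side (u : cell) : nat := N.+1 - csum u.

Definition base_line (u : cell) : seq cell := line xyz u.1.1 u.1.2 u.2 (side u).

Lemma reach_edge2 u : csum u <= N ->
  reach (side u ^ 2) (line (swap12 xyz) u.1.2 u.1.1 u.2 (side u)) (base_line u).
Proof.
move=> uN; apply: reach_flip; first exact: tri_coord_xyz.
by move: uN; rewrite /side /csum; lia.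
Qed.

Lemma perm_base_line u :
  perm_eq (line (swap23 xyz) u.1.1 u.2 u.1.2 (side u)) (base_line u).
Proof. exact: perm_line_swap23. Qed.

Lemma reach_edge3 u : csum u <= N ->
  reach (side u ^ 2) (line (swap12 (swap23 xyz)) u.2 u.1.1 u.1.2 (side u))
    (base_line u).
Proof.
move=> uN; apply: reach_permR (perm_base_line u) _.
apply: reach_flip; first exact/tri_coord_swap23/tri_coord_xyz.
by move: uN; rewrite /side /csum; lia.
Qed.

(** In each case [u] gives one coordinate of the maximum, and in that direction it starts one level
    past a corner of [w]. So the edge of [u] on its lowest level can be swept over an edge of
    [w]. *)
Lemma reach_join_corner u w : csum u <= N -> csum w <= N ->
  csum (cmax u w) = N.+1 ->
  [\/ [/\ w.1.1 <= u.1.1, u.1.2 <= w.1.2 & u.2 <= w.2],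
      [/\ u.1.1 <= w.1.1, w.1.2 <= u.1.2 & u.2 <= w.2] |
      [/\ u.1.1 <= w.1.1, u.1.2 <= w.1.2 & w.2 <= u.2]] ->
  reach (3 * side (cmin u w) ^ 2) (base_line u ++ base_line w)
    (base_line (cmin u w)).
Proof.
move=> uN wN mN.
have [sE mle] : side (cmin u w) = side u + side w /\ csum (cmin u w) <= N.
  by move: uN wN mN; rewrite /side /csum /cmin /cmax /=; lia.
have e2 v vN := reach_sym (@reach_edge2 v vN).
have e3 v vN := reach_sym (@reach_edge3 v vN).
have cost := (fun m => @reach_le m (3 * side (cmin u w) ^ 2)).
move: uN wN mN mle (sE); rewrite {1 2 3 4}/csum /cmax /= => uN wN mN mle sE'.
case=> -[h1 h2 h3].
- apply: (cost (side w ^ 2 + side w * (side u + side w))); first by rewrite sE; nia.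
  apply: reach_trans (reach_cat (reach_perm 0 (perm_refl _)) (e2 w wN)) _.
  have {1}-> : base_line u = line xyz (w.1.1 + side w) u.1.2 u.2 (side u).
    by rewrite /base_line; congr line; rewrite /side /csum; lia.
  rewrite /base_line sE.
  have -> : cmin u w = (w.1.1, u.1.2, u.2).
    by rewrite /cmin; congr (_, _, _); lia.
  apply: reach_merge => //; first exact: tri_coord_xyz.
    by rewrite /side /csum; lia.
  by rewrite /side /csum; lia.
(* The sweep now runs along the second coordinate: the line of [u] is turned, swept over
   [base_line w] as it is, and the result is turned back. The last case does the same along the
   third coordinate. *)
- apply: (cost (side u ^ 2 + (side w * (side u + side w) + side (cmin u w) ^ 2))).
    by rewrite sE; nia.
  apply: reach_trans (reach_catr _ (e2 u uN)) _.
  apply: reach_trans _ (@reach_edge2 (cmin u w) mle).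
  have -> : line (swap12 xyz) u.1.2 u.1.1 u.2 (side u) =
            line (swap12 xyz) (w.1.2 + side w) u.1.1 u.2 (side u).
    by congr line; rewrite /side /csum; lia.
  rewrite sE; have -> : cmin u w = (u.1.1, w.1.2, u.2).
    by rewrite /cmin; congr (_, _, _); lia.
  apply: (@reach_merge (swap12 xyz)) => //; first exact/tri_coord_swap12/tri_coord_xyz.
    by rewrite /side /csum; lia.
  by rewrite /side /csum; lia.
- apply: (cost (side u ^ 2 + (side w * (side u + side w) + side (cmin u w) ^ 2))).
    by rewrite sE; nia.
  apply: reach_trans (reach_catr _ (e3 u uN)) _.
  apply: reach_trans _ (@reach_edge3 (cmin u w) mle).
  have -> : line (swap12 (swap23 xyz)) u.2 u.1.1 u.1.2 (side u) =
            line (swap12 (swap23 xyz)) (w.2 + side w) u.1.1 u.1.2 (side u).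
    by congr line; rewrite /side /csum; lia.
  rewrite sE; have -> : cmin u w = (u.1.1, u.1.2, w.2).
    by rewrite /cmin; congr (_, _, _); lia.
  set s := line _ _ _ _ _.
  apply: (@reach_permL _ _ (s ++ line (swap23 xyz) w.1.1 w.2 w.1.2 (side w))).
    by rewrite perm_cat2l perm_sym perm_base_line.
  apply: (@reach_merge (swap12 (swap23 xyz))) => //.
  + exact/tri_coord_swap12/tri_coord_swap23/tri_coord_xyz.
  + by rewrite /side /csum; lia.
  + by rewrite /side /csum; lia.
Qed.

Lemma cminC u w : cmin u w = cmin w u.
Proof. by rewrite /cmin minnC (minnC u.1.2) (minnC u.2). Qed.

Lemma cmaxC u w : cmax u w = cmax w u.
Proof. by rewrite /cmax maxnC (maxnC u.1.2) (maxnC u.2). Qed.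

(* Disjoint touching triangles meet at a corner of one of them, namely of the
   one that contributes two coordinates to the maximum. *)
Lemma reach_join u w : csum u <= N -> csum w <= N ->
  csum (cmax u w) = N.+1 ->
  reach (3 * side (cmin u w) ^ 2) (base_line u ++ base_line w)
    (base_line (cmin u w)).
Proof.
move=> uN wN mN.
pose C u w := [\/ [/\ w.1.1 <= u.1.1, u.1.2 <= w.1.2 & u.2 <= w.2],
      [/\ u.1.1 <= w.1.1, w.1.2 <= u.1.2 & u.2 <= w.2] |
      [/\ u.1.1 <= w.1.1, u.1.2 <= w.1.2 & w.2 <= u.2]].
have [h|h] : C u w \/ C w u; last first.
- rewrite cminC; apply: (@reach_permL _ _ (base_line w ++ base_line u)).
    by rewrite perm_catC.
  by apply: reach_join_corner => //; rewrite cmaxC.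
- exact: reach_join_corner.
move: uN wN mN; rewrite /csum /cmax /= => uN wN mN.
(* Neither triangle gives all three coordinates of the maximum, whose sum [N.+1] is too large for
   that. *)
case: (leqP u.1.1 w.1.1) (leqP u.1.2 w.1.2) (leqP u.2 w.2) => h1 [] h2 [] h3;
  try lia;
  by [left; constructor 1; split; lia | left; constructor 2; split; lia
     | left; constructor 3; split; lia | right; constructor 1; split; lia
     | right; constructor 2; split; lia | right; constructor 3; split; lia].
Qed.

(** * Filling sets and the telescoping cost *)

(** The closure is encoded impredicatively, so that any closed [D] can be plugged in: a union of
    triangles, or an invariant of a completion run. *)
Definition fills (L : seq cell) : Prop :=
  forall D : cell -> Prop,
    (forall c d e, tri N c d e -> D c -> D d -> D e) ->
    (forall u c, u \in L -> cle u c -> csum c = N -> D c) ->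
  forall c, csum c = N -> D c.

Lemma fills_perm L L' : perm_eq L L' -> fills L -> fills L'.
Proof.
move=> p f D Dt DL; apply: f => // u c uL; apply: DL.
by rewrite -(perm_mem p).
Qed.

Lemma fills_join u w L : fills (u :: w :: L) -> fills (cmin u w :: L).
Proof.
move=> f D Dt DL; apply: f => // v c; rewrite !inE.
have DM : cle (cmin u w) c -> csum c = N -> D c by apply: DL; rewrite inE eqxx.
case/or3P=> [/eqP->|/eqP->|vL] vc.
- by apply: DM; move: vc; rewrite /cle /=; lia.
- by apply: DM; move: vc; rewrite /cle /=; lia.
- by apply: DL vc; rewrite inE vL orbT.
Qed.

(* Pairwise non-touching triangles form a closed set. *)
Lemma fills_separated L : fills L ->
  (forall u w, u \in L -> w \in L -> u != w -> N.+1 < csum (cmax u w)) ->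
  (0, 0, 0) \in L.
Proof.
move=> f sep.
have {}f c : csum c = N -> exists2 u, u \in L & cle u c.
  apply: (f (fun c => exists2 u, u \in L & cle u c)) => [|u {}c]; last by exists u.
  move=> _ _ _ [v [p [q [r [vN /and3P[pq pr qr] -> -> ->]]]]] [u uL uc] [w wL wc].
  have [uw|uw] := eqVneq u w.
    exists u => //; move: uc wc pq pr qr; rewrite -uw /cle /corner.
    case: (T_cases p) => ->; case: (T_cases q) => ->; case: (T_cases r) => -> //=;
      lia.
  (* [cmax u w] lies below the maximum of two distinct corners, whose sum is [csum v + 2], that is
     [N.+1]. *)
  have := sep _ _ uL wL uw; move: uc wc pq vN; rewrite /cle /corner /csum /cmax.
  by case: (T_cases p) => ->; case: (T_cases q) => -> //=; lia.
(* A triangle covering this corner of [T_n] has the form [(u0, 0, 0)]. *)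
have [|[[u0 u1] u2] uL uc] := f (N, 0, 0); first by rewrite /csum /= !addn0.
have [u00|u0p] := posnP u0.
  by move: uc uL; rewrite /cle /= u00 !leqn0 => /and3P[_ /eqP-> /eqP->].
have u0N : u0 <= N by case/and3P: uc.
(* The first cell past [u] on the edge with third coordinate 0: a triangle [w] covering it has
   [csum (cmax u w)] at most [u0 + (N - u0.-1)], that is [N.+1]. *)
have [|[[w0 w1] w2] wL wc] := f (u0.-1, N - u0.-1, 0); first by rewrite /csum /=; lia.
have uw : (u0, u1, u2) != (w0, w1, w2).
  by apply/eqP => -[]; move: wc; rewrite /cle /=; lia.
have := sep _ _ uL wL uw; move: uc wc; rewrite /cle /csum /cmax /=; lia.
Qed.

(** Induction on the number of triangles. The lower bound is proved alongside because it forces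
    every join to be exact in the case of equality. *)
Lemma reach_fills L : (forall u, u \in L -> csum u <= N) -> fills L ->
  N.+1 <= \sum_(u <- L) side u /\
  (\sum_(u <- L) side u = N.+1 -> exists2 m,
     reach m (flatten (map base_line L)) (base_line (0, 0, 0)) &
     m + 2 * \sum_(u <- L) side u ^ 3 <= 2 * N.+1 ^ 3).
Proof.
have [k] := ubnP (size L); elim: k L => // k IH L; rewrite ltnS => Lk LN f.
have side0 : side (0, 0, 0) = N.+1 by [].
have [[u [w [L' [LE m]]]]|sep] := classic (exists u w L',
    perm_eq L (u :: w :: L') /\ csum (cmax u w) <= N.+1); last first.
  have {}sep : (0, 0, 0) \in L.
    apply: fills_separated => // u w uL wL uw; rewrite ltnNge; apply/negP => h.
    apply: sep; exists u, w, (rem w (rem u L)); split=> //.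
    rewrite (perm_trans (perm_to_rem uL)) // perm_cons perm_to_rem //.
    by move: wL; rewrite (perm_mem (perm_to_rem uL)) inE eq_sym (negPf uw).
  rewrite (perm_big _ (perm_to_rem sep)) big_cons side0 /=; split; first exact: leq_addr.
  (* All sides are positive, so a total of [N.+1] leaves room for the whole triangle only. *)
  have : {in rem (0, 0, 0) L, forall u, 0 < side u}.
    by move=> u /mem_rem/LN; rewrite /side; lia.
  case E : (rem _ L) (perm_to_rem sep) => [|u L'] p pos; last first.
    by rewrite big_cons; have := pos u (mem_head _ _); lia.
  move=> _; exists 0; last by rewrite (perm_big _ p) !big_cons !big_nil side0 /=; lia.
  apply: reach_perm; rewrite -[X in perm_eq _ X]cats0.
  exact: (perm_flatten (perm_map base_line p)).
have mem v : (v \in L) = (v \in u :: w :: L') := perm_mem LE v.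
have uN : csum u <= N by apply: LN; rewrite mem !inE eqxx.
have wN : csum w <= N by apply: LN; rewrite mem !inE eqxx orbT.
have mN : csum (cmin u w) <= N by move: uN; rewrite /csum /cmin /=; lia.
have sE : side (cmin u w) + N.+1 = side u + side w + csum (cmax u w).
  by move: uN wN; rewrite /side /csum /cmin /cmax /=; lia.
have [|||le IHr] := IH (cmin u w :: L').
- by move: Lk; rewrite (perm_size LE) /=; lia.
- move=> v; rewrite inE => /predU1P[->//|vL].
  by apply: LN; rewrite mem !inE vL !orbT.
- by apply: fills_join; apply: fills_perm f.
have sumE (F : cell -> nat) :
    \sum_(v <- L) F v = F u + (F w + \sum_(v <- L') F v).
  by rewrite (perm_big _ LE) !big_cons.
rewrite sumE; move: le IHr; rewrite !big_cons => le IHr.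
split=> [|eqN]; first by lia.
(* The lower bound [le] after the join and the equality before it leave no slack. *)
have [|m1 r1 c1] := IHr; first by lia.
have jN : csum (cmax u w) = N.+1 by lia.
exists (3 * side (cmin u w) ^ 2 + m1).
  apply: (@reach_permL _ _ ((base_line u ++ base_line w) ++
                             flatten (map base_line L'))).
    by rewrite -catA; exact: (perm_flatten (perm_map base_line LE)).
  by apply: reach_trans r1; apply/reach_catr/reach_join.
rewrite sumE.
have [su sw] : 0 < side u /\ 0 < side w by rewrite /side; lia.
have {}sE : side (cmin u w) = side u + side w by lia.
move: c1; rewrite sE; set S := \sum_(_ <- _) _.
move: (side u) (side w) su sw => a b a0 b0.
(* Times [3 * (a + b)], this bounds the cost 3 (a + b)^2 by 6 a b (a + b), which is 2 ((a + b)^3 -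
   a^3 - b^3). *)
have : a + b <= 2 * (a * b) by nia.
rewrite -(leq_pmul2r (_ : 0 < 3 * (a + b))); last by lia.
rewrite !expnS !expn0; nia.
Qed.

End Reach.

(** * Passage between [Tn] and barycentric cells *)

Section Coordinates.
Variable N : nat.

Lemma Tn_top_subproof : N.+1.-1 <= (@ord_max N, @ord_max N).1 + (@ord_max N, @ord_max N).2.
Proof. exact: leq_addl. Qed.

Definition Tn_top : Tn N.+1 := exist _ (ord_max, ord_max) Tn_top_subproof.

Definition of_cell (c : cell) : Tn N.+1 :=
  insubd Tn_top (inord (N - c.1.1), inord (N - c.1.2)).

Definition to_cell (d : Tn N.+1) : cell :=
  (N - (coords d).1, N - (coords d).2, (coords d).1 + (coords d).2 - N).

Lemma coords_of_cell c : csum c = N -> coords (of_cell c) = (N - c.1.1, N - c.1.2).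
Proof.
move=> cN; rewrite /coords /of_cell val_insubd /= !inordK ?ltnS ?leq_subr //.
have -> : N <= N - c.1.1 + (N - c.1.2) by move: cN; rewrite /csum; lia.
by rewrite /= !inordK ?ltnS ?leq_subr.
Qed.

Lemma coords_inj n : injective (@coords n).
Proof.
move=> [[a b] h] [[a' b'] h'] [] /= e1 e2; apply: val_inj => /=.
by congr pair; apply: val_inj.
Qed.

Lemma coords_bounds (d : Tn N.+1) :
  [/\ (coords d).1 <= N, (coords d).2 <= N & N <= (coords d).1 + (coords d).2].
Proof.
by case: d => -[a b] h; split; rewrite /coords //=; rewrite -ltnS ltn_ord.
Qed.

Lemma csum_to_cell d : csum (to_cell d) = N.
Proof. by case: (coords_bounds d); rewrite /csum /to_cell /=; lia. Qed.

Lemma to_cellK : cancel to_cell of_cell.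
Proof.
move=> d; apply: coords_inj; rewrite coords_of_cell ?csum_to_cell //= !subKn;
  by case: (coords_bounds d) => // *; case: (coords d).
Qed.

Lemma of_cellK c : csum c = N -> to_cell (of_cell c) = c.
Proof.
move=> cN; rewrite /to_cell coords_of_cell //=; move: cN.
by case: c => -[x y] z; rewrite /csum /= => cN; congr (_, _, _); lia.
Qed.

Lemma csum_corner v t : csum v + 1 = N -> csum (corner v t) = N.
Proof. by case: (T_cases t) => ->; rewrite /csum /corner /=; lia. Qed.

Lemma translate_corner v : csum v + 1 = N ->
  translate (fun t => of_cell (corner v t)).
Proof.
move=> vN; exists (N - v.1.1 - 1, N - v.1.2 - 1) => t.
rewrite coords_of_cell ?csum_corner //; move: vN.
by case: (T_cases t) => ->; rewrite /csum /corner /= => vN; congr pair; lia.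
Qed.

Lemma tri_translate (w : T -> Tn N.+1) (p q r : T) : translate w ->
  p != q -> p != r -> q != r ->
  tri N (to_cell (w p)) (to_cell (w q)) (to_cell (w r)).
Proof.
case=> v wv pq pr qr.
have b t := coords_bounds (w t).
exists (N - v.1 - 1, N - v.2 - 1, v.1 + v.2 + 1 - N), p, q, r.
have : [/\ v.1 + 1 <= N, v.2 + 1 <= N & N <= v.1 + v.2 + 1].
  by have [] := b t01; have [] := b t10; rewrite !wv /= => *; split; lia.
move=> [b1 b2 b3]; split; rewrite ?pq ?pr ?qr //; first by rewrite /csum /=; lia.
- by rewrite /to_cell wv /corner; case: (T_cases p) => -> /=; congr (_, _, _); lia.
- by rewrite /to_cell wv /corner; case: (T_cases q) => -> /=; congr (_, _, _); lia.
- by rewrite /to_cell wv /corner; case: (T_cases r) => -> /=; congr (_, _, _); lia.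
Qed.

End Coordinates.

(** * Moves and reorderings as basic permutations *)

Section Realise.
Variables (Sigma : finType) (R : {set {ffun T -> Sigma}}) (n : nat).
Hypothesis tepR : TEP R.

Definition view (e : {ffun 'I_n -> Tn n}) (q : {ffun Tn n -> Sigma}) :
  {ffun 'I_n -> Sigma} := [ffun i => q (e i)].

(** One list serves all valid patterns at once. Products of permutations act from left to right, so
    the head of [s] is applied first. *)
Definition realised (m : nat) (e e' : {ffun 'I_n -> Tn n}) : Prop :=
  exists s : seq {perm {ffun 'I_n -> Sigma}},
    [/\ forall pi, pi \in s -> basic_perm pi, size s <= m &
        forall q, valid R q -> view e' q = (\prod_(pi <- s) pi)%g (view e q)].

Lemma realised_refl m e : realised m e e.
Proof. by exists [::]; split=> // q _; rewrite big_nil perm1. Qed.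

Lemma realised_le m m' e e' : m <= m' -> realised m e e' -> realised m' e e'.
Proof. by move=> le [s [b z h]]; exists s; split=> //; apply: leq_trans le. Qed.

Lemma realised_trans m1 m2 e1 e2 e3 :
  realised m1 e1 e2 -> realised m2 e2 e3 -> realised (m1 + m2) e1 e3.
Proof.
move=> [s1 [b1 z1 h1]] [s2 [b2 z2 h2]]; exists (s1 ++ s2); split.
- by move=> pi; rewrite mem_cat => /orP[/b1|/b2].
- by rewrite size_cat leq_add.
- by move=> q vq; rewrite big_cat permM /= -h1 // h2.
Qed.

Definition on_pair (i j : 'I_n) (h : Sigma * Sigma -> Sigma * Sigma)
    (a : {ffun 'I_n -> Sigma}) : {ffun 'I_n -> Sigma} :=
  [ffun k => if k == i then (h (a i, a j)).1
             else if k == j then (h (a i, a j)).2 else a k].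

Lemma on_pair_inj i j h : i != j -> injective h -> injective (on_pair i j h).
Proof.
move=> ij hinj a b /ffunP ab.
have [ei ej] : a i = b i /\ a j = b j.
  suff /hinj[-> ->] : h (a i, a j) = h (b i, b j) by [].
  have := ab i; have := ab j; rewrite !ffunE eqxx eq_sym (negPf ij) eqxx.
  by case: (h _) => ? ?; case: (h _) => ? ? /= -> ->.
apply/ffunP => k; have := ab k; rewrite !ffunE.
by have [->|_] := eqVneq k i; last have [->|_] := eqVneq k j.
Qed.

Lemma realised_on_pair e e' i j h : i != j -> injective h ->
  (forall q, valid R q -> view e' q = on_pair i j h (view e q)) ->
  realised 1 e e'.
Proof.
move=> ij hinj eq_e'; exists [:: perm (on_pair_inj ij hinj)]; split=> //.
  move=> pi; rewrite inE => /eqP->; exists i, j, (perm hinj); split=> // a.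
  by rewrite permE; apply/ffunP => k; rewrite !ffunE permE.
by move=> q vq; rewrite big_seq1 permE eq_e'.
Qed.

Definition pattern3 (p q : T) (x y s : Sigma) : {ffun T -> Sigma} :=
  [ffun t => if t == p then x else if t == q then y else s].

Definition third (p q : T) (x y : Sigma) : Sigma :=
  odflt x [pick s | pattern3 p q x y s \in R].

Lemma thirdP p q r x y : p != q -> p != r -> q != r ->
  pattern3 p q x y (third p q x y) \in R.
Proof.
move=> pq pr qr; rewrite /third; case: pickP => //= none.
by have [s [sR _]] := tepR pq pr qr x y; have := none s; rewrite /pattern3 sR.
Qed.

Lemma T_third (p q r t : T) : p != q -> p != r -> q != r ->
  [|| t == p, t == q | t == r].
Proof.
by case: (T_cases p) => ->; case: (T_cases q) => ->; case: (T_cases r) => -> //;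
  case: (T_cases t) => ->.
Qed.

Lemma third_unique p q r (f : {ffun T -> Sigma}) : p != q -> p != r -> q != r ->
  f \in R -> f r = third p q (f p) (f q).
Proof.
move=> pq pr qr fR.
rewrite (TEP_inj (c := r) tepR fR (thirdP (f p) (f q) pq pr qr)); last first.
  move=> t tr; rewrite ffunE; have := T_third t pq pr qr; rewrite (negPf tr) orbF.
  have [->//|_] := eqVneq t p; by move=> /= /eqP->; rewrite eqxx.
by rewrite !ffunE !eqxx [r == p]eq_sym [r == q]eq_sym [q == p]eq_sym (negPf pq) (negPf pr) (negPf qr).
Qed.

(** TEP at [p]: the symbols at [q] and [r] determine the one at [p]. This is what makes a move a
    permutation of pairs. *)
Lemma third_inj p q r y : p != q -> p != r -> q != r ->
  injective (fun x => third p q x y).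
Proof.
move=> pq pr qr x x' eqt.
have h1 := thirdP x y pq pr qr; have h2 := thirdP x' y pq pr qr.
have /ffunP/(_ p) : pattern3 p q x y (third p q x y) =
    pattern3 p q x' y (third p q x' y).
  apply: (TEP_inj (c := p) tepR h1 h2) => t tp.
  by rewrite !ffunE (negPf tp) eqt.
by rewrite !ffunE eqxx.
Qed.

Lemma realised_move (e e' : {ffun 'I_n -> Tn n}) i j (w : T -> Tn n) p q r : translate w ->
  p != q -> p != r -> q != r -> i != j ->
  e i = w p -> e j = w q -> e' i = w r -> (forall k, k != i -> e' k = e k) ->
  realised 1 e e'.
Proof.
move=> tw pq pr qr ij ei ej e'i e'k.
pose h (a : Sigma * Sigma) := (third p q a.1 a.2, a.2).
apply: (@realised_on_pair _ _ i j h) => //.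
  move=> [x y] [x' y'] [] /= + yy'; rewrite -yy' => /(third_inj pq pr qr) -> //.
move=> a va; apply/ffunP => k; rewrite !ffunE /=.
have [->|ki] := eqVneq k i; last by have [->|_] := eqVneq k j; rewrite e'k // eq_sym.
rewrite e'i ei ej; have := third_unique pq pr qr (va w tw).
by rewrite !ffunE.
Qed.

Lemma realised_tperm e i j : i != j ->
  realised 1 e [ffun k => e (tperm i j k)].
Proof.
move=> ij; apply: (@realised_on_pair _ _ i j (fun a => (a.2, a.1))) => //.
  by move=> [x y] [x' y'] [-> ->].
move=> q _; apply/ffunP => k; rewrite !ffunE /=.
by case: tpermP => [->|->|/eqP/negPf-> /eqP/negPf->] //; rewrite ?eqxx // eq_sym (negPf ij).
Qed.

Lemma realised_perm_support e (sg : {perm 'I_n}) :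
  realised #|[set i | sg i != i]| e [ffun i => e (sg i)].
Proof.
have [k] := ubnP #|[set i | sg i != i]|; elim: k sg e => // k IH sg e lek.
have [[i mi]|none] := classic (exists i, sg i != i); last first.
  have -> : [ffun i => e (sg i)] = e; last exact: realised_refl.
  apply/ffunP => i; rewrite ffunE; have [->//|h] := eqVneq (sg i) i.
  by case: none; exists i.
(* [ta] fixes [j] and all fixed points of [sg], so its support is strictly smaller. *)
pose j := sg i; pose ta := (tperm i j * sg)%g.
have sub : #|[set k | ta k != k]| < #|[set k | sg k != k]|.
  apply: proper_card; apply/properP; split; last first.
    exists j; rewrite inE; last by rewrite permM tpermR eqxx.
    by rewrite (inj_eq perm_inj).
  apply/subsetP => x; rewrite !inE permM; case: tpermP => [->//|->|//].
  by rewrite eqxx.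
apply: (@realised_le (#|[set k | ta k != k]| + 1)); first by rewrite addn1.
apply: realised_trans (IH ta e (leq_trans sub lek)) _.
have -> : [ffun k => e (sg k)] =
    [ffun k => [ffun k' => e (ta k')] (tperm i j k)].
  by apply/ffunP => x; rewrite !ffunE permM tpermK.
by apply: realised_tperm; rewrite eq_sym.
Qed.

Lemma realised_perm e (sg : {perm 'I_n}) : realised n e [ffun i => e (sg i)].
Proof.
apply: realised_le (realised_perm_support e sg).
by rewrite -[X in _ <= X]card_ord max_card.
Qed.

(** Used to find the indices that carry the two cells of a move. As [f] may repeat values, positions
    are permuted. *)
Lemma perm_map_inv (A B : eqType) (f : A -> B) (r : seq A) (s : seq B) :
  perm_eq s (map f r) -> exists2 r', perm_eq r' r & s = map f r'.
Proof.
move=> p; case: r p => [|x0 r] p; first by exists [::] => //; apply: perm_nilP.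
case/(perm_iotaP (f x0)): p => Is pI ->.
exists (map (nth x0 (x0 :: r)) Is).
  rewrite -[X in perm_eq _ X](mkseq_nth x0); apply: perm_map.
  by rewrite size_map in pI.
rewrite -map_comp; apply/eq_in_map => i iI; rewrite (nth_map x0) //.
by move: iI; rewrite (perm_mem pI) mem_iota size_map.
Qed.

Lemma realised_of_perm_eq (e e' : {ffun 'I_n -> Tn n}) :
  perm_eq (map e (enum 'I_n)) (map e' (enum 'I_n)) -> realised n e e'.
Proof.
rewrite perm_sym => /(@tuple_permP _ _ _ [tuple e i | i < n])[sg eq_e].
suff -> : e' = [ffun i => e (sg i)] by apply: realised_perm.
apply/ffunP => i; rewrite ffunE.
have {1}<- : nth (e' i) (map e' (enum 'I_n)) i = e' i.
  by rewrite (nth_map i) ?size_enum_ord // nth_ord_enum.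
by rewrite eq_e -tnth_nth !tnth_mktuple.
Qed.

End Realise.

(** * From bases to the theorem *)

Lemma realised_reach (Sigma : finType) (R : {set {ffun T -> Sigma}}) N m s t :
  TEP R -> reach N m s t -> forall e : {ffun 'I_N.+1 -> Tn N.+1},
  perm_eq (map e (enum 'I_N.+1)) (map (@of_cell N) s) ->
  exists2 e' : {ffun 'I_N.+1 -> Tn N.+1},
    perm_eq (map e' (enum 'I_N.+1)) (map (@of_cell N) t) & realised R m e e'.
Proof.
move=> tep; elim=> [{}m {}s {}t st|c d c' {}s tr|m1 m2 {}s {}t u _ IH1 _ IH2] e es.
- exists e; last exact: realised_refl.
  exact: perm_trans es (perm_map _ st).
- case: tr es => v [p [q [r [vN /and3P[pq pr qr] -> -> ->]]]].
  rewrite perm_sym => /perm_map_inv[[|i [|j I]] // pI [ei ej eI]].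
  have : uniq (i :: j :: I) by rewrite (perm_uniq pI) enum_uniq.
  rewrite /= inE negb_or => /and3P[/andP[ij iI] _ _].
  pose e' := [ffun k => if k == i then of_cell N (corner v r) else e k].
  exists e'; last first.
    apply: (realised_move (e' := e') tep (translate_corner vN) pq pr qr ij);
      rewrite ?ffunE ?eqxx //.
    by move=> k ki; rewrite ffunE (negPf ki).
  rewrite perm_sym (perm_trans _ (perm_map e' pI)) //= !ffunE eqxx eq_sym (negPf ij).
  rewrite -ej eI; suff -> : map e' I = map e I by [].
  apply/eq_in_map => k kI; rewrite ffunE; case: eqP => // ki.
  by rewrite -ki kI in iI.
- have [e1 p1 r1] := IH1 e es; have [e2 p2 r2] := IH2 e1 p1.
  by exists e2 => //; apply: realised_trans r1 r2.
Qed.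

(** A completion run from the constant pattern [x0] ends with every cell assigned, and membership of
    all assigned cells in [D] is an invariant of the run. *)
Lemma basis_fills (Sigma : finType) (R : {set {ffun T -> Sigma}}) N
    (P : {set Tn N.+1}) (e : 'I_N.+1 -> {d | d \in P}) (x0 : Sigma) :
  is_basis R P -> bijective e ->
  fills N [seq to_cell (val (e i)) | i <- enum 'I_N.+1].
Proof.
move=> bP [f fK eK] D Dtri DP c cN.
have [u ru eu] := fill_ends R (start [ffun _ : {d | d \in P} => x0]).
have [q _ uq] := bP _ _ ru eu.
have : forall d, u d != None -> D (to_cell d).
  have st d : start [ffun _ : {d | d \in P} => x0] d != None -> D (to_cell d).
    rewrite ffunE; case: insubP => //= d' _ <- _.
    apply: (DP (to_cell (val d'))); last exact: csum_to_cell.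
      by apply/mapP; exists (f d'); rewrite ?mem_enum ?eK.
    by rewrite /cle !leqnn.
  elim: ru st {eu uq} => // u1 u2 u3 [w [k [r [tw _ _ ur ->]]]] _ IH Du.
  apply: IH => d; rewrite ffunE; have [-> _|_] := eqVneq d (w k); last exact: Du.
  have [a [b [ab ak bk]]] : exists a b : T, [/\ a != b, a != k & b != k].
    by case: (T_cases k) => ->; [exists t11, t10 | exists t01, t10 | exists t01, t11].
  by apply: Dtri (tri_translate tw ab ak bk) _ _; apply: Du; rewrite ur.
by move=> /(_ (of_cell N c)); rewrite uq ffunE of_cellK //; apply.
Qed.

(** Each cell is a triangle of side 1 and its own base line, so the sides of the [N.+1] cells add up
    to exactly [N.+1]. *)
Lemma basis_reach (Sigma : finType) (R : {set {ffun T -> Sigma}}) N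
    (P : {set Tn N.+1}) (e : 'I_N.+1 -> {d | d \in P}) (x0 : Sigma) :
  is_basis R P -> bijective e ->
  reach N (2 * N.+1 ^ 3) [seq to_cell (val (e i)) | i <- enum 'I_N.+1]
    (base_line N (0, 0, 0)).
Proof.
move=> bP be; have f := basis_fills x0 bP be; move: f.
set L := map _ _ => f.
have LN u : u \in L -> csum u = N by case/mapP => i _ ->; apply: csum_to_cell.
have [|_ h] := reach_fills _ f; first by move=> u /LN->.
have [|m r c] := h.
  transitivity (\sum_(u <- L) 1); last by rewrite sum1_size size_map size_enum_ord.
  by apply: eq_big_seq => u /LN; rewrite /side => ->; rewrite subSnn.
apply: (@reach_le _ m); first by lia.
suff <- : flatten (map (base_line N) L) = L by [].
elim: {f h r c} L LN => //= u L IH LN; rewrite IH; last first.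
  by move=> v vL; apply: LN; rewrite inE vL orbT.
have := LN u (mem_head _ _); rewrite /base_line /side => ->; rewrite subSnn /=.
by rewrite /line /mkseq /= /xyz !addn0; case: u {LN} => -[].
Qed.

Theorem theorem7 :
  exists C : nat,
  forall (Sigma : finType) (R : {set {ffun T -> Sigma}}) (n : nat)
         (P Q : {set Tn n}),
    TEP R -> 1 <= n ->
    is_basis R P -> is_basis R Q -> #|P| = n -> #|Q| = n ->
  forall (eP : 'I_n -> {d | d \in P}) (eQ : 'I_n -> {d | d \in Q}),
    bijective eP -> bijective eQ ->
  forall phi : {ffun 'I_n -> Sigma} -> {ffun 'I_n -> Sigma},
    (forall q : {ffun Tn n -> Sigma}, valid R q ->
       phi (restr eP q) = restr eQ q) ->
  exists s : seq {perm {ffun 'I_n -> Sigma}},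
    [/\ forall pi, pi \in s -> basic_perm pi,
        size s <= C * n ^ 3 &
        forall x, phi x = (\prod_(pi <- s) pi)%g x].
Proof.
(* Two for bringing [P] to the base line, two for going back to [Q], and one for the reordering, as
   n is at most n^3. *)
exists 5 => Sigma R [//|N] P Q tep _ bP bQ _ _ eP eQ bijP bijQ phi phiE.
(* Over an empty alphabet there is no configuration [x], because n is positive. *)
have [x0|empty] := pickP Sigma; last first.
  by exists [::]; split=> // x; have := empty (x ord0).
have r : reach N (4 * N.+1 ^ 3) [seq to_cell (val (eP i)) | i <- enum 'I_N.+1]
                             [seq to_cell (val (eQ i)) | i <- enum 'I_N.+1].
  rewrite (mulnDl 2 2); apply: reach_trans (basis_reach x0 bP bijP) _.
  exact/reach_sym/(basis_reach x0 bQ bijQ).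
pose e (P : {set Tn N.+1}) (eP : 'I_N.+1 -> {d | d \in P}) :=
  [ffun i => val (eP i)] : {ffun 'I_N.+1 -> Tn N.+1}.
have mapE (P' : {set Tn N.+1}) (eP' : 'I_N.+1 -> {d | d \in P'}) :
    map (@of_cell N) [seq to_cell (val (eP' i)) | i <- enum 'I_N.+1] =
    map (e P' eP') (enum 'I_N.+1).
  by rewrite -map_comp; apply: eq_map => i /=; rewrite to_cellK ffunE.
have [|e' pe' r1] := realised_reach tep r (e := e P eP); first by rewrite mapE.
rewrite mapE in pe'.
have [s [bs zs hs]] := realised_trans r1 (realised_of_perm_eq R pe').
exists s; split=> //.
  apply: leq_trans zs _.
  by rewrite (mulnDl 4 1) mul1n leq_add2l -{1}[N.+1]expn1 leq_pexp2l.
move=> x; case: bijP => f fK eK.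
have [q [[vq qx] _]] := basis_unique_extension [ffun d => x (f d)] tep bP.
have -> : x = restr eP q by apply/ffunP => k; rewrite ffunE qx ffunE fK.
rewrite phiE //; have := hs q vq; rewrite /view.
have viewE (P' : {set Tn N.+1}) (eP' : 'I_N.+1 -> {d | d \in P'}) :
    [ffun i => q (e P' eP' i)] = restr eP' q.
  by apply/ffunP => k; rewrite !ffunE.
by rewrite !viewE.
Qed.
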